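(* Let $P=\{p_1,\ldots,p_n\}$ be a finite poset and $r\ge1$. The set $\mathcal G$ of elements $$y_{\mathcal I}y_{\mathcal I'}-y_{\mathcal I\cup\mathcal I'}y_{\mathcal I\cap\mathcal I'}\in T,\qquad \mathcal I,\mathcal I'\in\mathcal I_r(P)\ \text{incomparable},$$ is a reduced Gröbner basis of the ideal $L_r=\operatorname{Ker}\varphi$ with respect to the reverse lexicographic order induced by the given order of the variables $y_{\mathcal I}$.
   Context: $K$ is a field and $S=K[x_{ij} : 1\le i\le r,\ 1\le j\le n]$. A poset ideal of $P$ is a down-closed subset (possibly empty). $\mathcal I_r(P)$ is the set of multichains $\mathcal I: I_1\subseteq\cdots\subseteq I_r=P$ of poset ideals of $P$, partially ordered by $\mathcal I\le\mathcal I'$ iff $I_i\subseteq I'_i$ for all $i$. It is a distributive lattice with meet $\mathcal I\cap\mathcal I'$ given by $(\mathcal I\cap\mathcal I')_i=I_i\cap I'_i$ and join $\mathcal I\cup\mathcal I'$ given by $(\mathcal I\cup\mathcal I')_i=I_i\cup I'_i$. With $I_0=\emptyset$, put $u_{\mathcal I}=\prod_{j=1}^r\prod_{p_k\in I_j\setminus I_{j-1}}x_{jk}\in S$. $R_r(P)=K[u_{\mathcal I} : \mathcal I\in\mathcal I_r(P)]\subset S$ is the toric ring generated by these monomials; $T=K[y_{\mathcal I} : \mathcal I\in\mathcal I_r(P)]$ is a polynomial ring; $\varphi:T\to R_r(P)$ is the surjective $K$-algebra homomorphism with $\varphi(y_{\mathcal I})=u_{\mathcal I}$. The given order of the variables is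 any fixed total order with the property that $\mathcal I<\mathcal I'$ implies $y_{\mathcal I}>y_{\mathcal I'}$. The reverse lexicographic order is the graded reverse lexicographic order. *)

(* Defs.v *)
From HB Require Import structures.
From mathcomp Require Import all_boot all_order all_algebra.
From mathcomp Require Import finmap.
From mathcomp Require Import mpoly.

Set Implicit Arguments.
Unset Strict Implicit.
Unset Printing Implicit Defensive.

Import Order.TTheory GRing.Theory.

Local Open Scope ring_scope.

Definition poset_ideal (d : Order.disp_t) (P : finPOrderType d) (A : {set P}) :
    bool :=
  [forall x in A, forall y : P, (y <= x)%O ==> (y \in A)].

(* The tuple lists I_1, ..., I_r; thus nth set0 (set0 :: I) j is I_j for
   0 <= j <= r, with the convention that I_0 is empty. *)
Definition is_multichain (d : Order.disp_t) (P : finPOrderType d) (r : nat)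
    (I : r.-tuple {set P}) : bool :=
  [&& all (@poset_ideal d P) I,
      sorted (fun A B : {set P} => A \subset B) I
    & last set0 I == [set: P]].

Record multichain (r : nat) (d : Order.disp_t) (P : finPOrderType d) :=
  Multichain {
    mchain :> r.-tuple {set P};
    _ : is_multichain mchain }.

HB.instance Definition _ (r : nat) (d : Order.disp_t) (P : finPOrderType d) :=
  [isSub for @mchain r d P].
HB.instance Definition _ (r : nat) (d : Order.disp_t) (P : finPOrderType d) :=
  [Finite of multichain r P by <:].

Section MultichainLattice.

Variables (r : nat) (d : Order.disp_t) (P : finPOrderType d).
Implicit Types I J : multichain r P.

Lemma poset_idealP (A : {set P}) :
  reflect (forall x y : P, x \in A -> (y <= x)%O -> y \in A) (poset_ideal A).
Proof.
apply: (iffP forall_inP) => [h x y xA yx | h x xA].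
  by move/forallP/(_ y)/implyP: (h x xA); apply.
by apply/forallP => y; apply/implyP; apply: h.
Qed.

Lemma poset_idealI (A B : {set P}) :
  poset_ideal A -> poset_ideal B -> poset_ideal (A :&: B).
Proof.
move=> /poset_idealP hA /poset_idealP hB; apply/poset_idealP => x y.
by rewrite !inE => /andP[xA xB] yx; rewrite (hA x) // (hB x).
Qed.

Lemma poset_idealU (A B : {set P}) :
  poset_ideal A -> poset_ideal B -> poset_ideal (A :|: B).
Proof.
move=> /poset_idealP hA /poset_idealP hB; apply/poset_idealP => x y.
rewrite !inE => /orP[xA | xB] yx.
  by rewrite (hA x).
by rewrite (hB x) ?orbT.
Qed.

Lemma multichain_map2 (op : {set P} -> {set P} -> {set P}) I J :
    (forall A B, poset_ideal A -> poset_ideal B -> poset_ideal (op A B)) ->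
    (forall A A' B B' : {set P},
        A \subset A' -> B \subset B' -> op A B \subset op A' B') ->
    op set0 set0 = set0 -> op [set: P] [set: P] = [set: P] ->
  is_multichain [tuple op (tnth I i) (tnth J i) | i < r].
Proof.
move=> opI opS op0 opT.
have nthE k : nth set0 [tuple op (tnth I i) (tnth J i) | i < r] k
              = op (nth set0 I k) (nth set0 J k).
  case: (ltnP k r) => [kr | rk]; last by rewrite !nth_default ?size_tuple.
  by rewrite -[k]/(val (Ordinal kr)) -!tnth_nth tnth_mktuple.
case: I J nthE => I /= /and3P[idI ltI lI] [J /= /and3P[idJ ltJ lJ]] nthE.
move/(all_nthP set0): idI => idI; move/(all_nthP set0): idJ => idJ.
move/(sortedP set0): ltI => ltI; move/(sortedP set0): ltJ => ltJ.
rewrite size_tuple in idI; rewrite size_tuple in idJ.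
rewrite size_tuple in ltI; rewrite size_tuple in ltJ.
apply/and3P; split.
- apply/(all_nthP set0) => k; rewrite size_tuple => kr.
  by rewrite nthE; apply: opI; [apply: idI | apply: idJ].
- apply/(sortedP set0) => k; rewrite size_tuple => kr.
  by rewrite !nthE; apply: opS; [apply: ltI | apply: ltJ].
- rewrite -nth_last nthE size_tuple.
  move: lI lJ; rewrite -!nth_last !size_tuple => /eqP-> /eqP->.
  by rewrite opT.
Qed.

Lemma mc_meet_subproof I J :
  is_multichain [tuple tnth I i :&: tnth J i | i < r].
Proof.
apply: (@multichain_map2 (@setI P)); first exact: poset_idealI.
- by move=> *; apply: setISS.
- exact: setI0.
- exact: setIT.
Qed.

Lemma mc_join_subproof I J :
  is_multichain [tuple tnth I i :|: tnth J i | i < r].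
Proof.
apply: (@multichain_map2 (@setU P)); first exact: poset_idealU.
- by move=> *; apply: setUSS.
- exact: setU0.
- exact: setUT.
Qed.

Definition mc_meet I J : multichain r P := Multichain (mc_meet_subproof I J).
Definition mc_join I J : multichain r P := Multichain (mc_join_subproof I J).
Definition mc_le I J : bool := [forall i : 'I_r, tnth I i \subset tnth J i].
Definition mc_lt I J : bool := (J != I) && mc_le I J.

Lemma tnth_meet I J i : tnth (mc_meet I J) i = tnth I i :&: tnth J i.
Proof. exact: tnth_mktuple. Qed.

Lemma tnth_join I J i : tnth (mc_join I J) i = tnth I i :|: tnth J i.
Proof. exact: tnth_mktuple. Qed.

Lemma mcP I J : (forall i, tnth I i = tnth J i) -> I = J.
Proof. by move=> h; apply/val_inj/eq_from_tnth. Qed.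

Lemma mc_le_def I J : mc_le I J = (mc_meet I J == I).
Proof.
apply/forallP/eqP => [h | <- i]; last by rewrite tnth_meet subsetIr.
by apply: mcP => i; rewrite tnth_meet; apply/setIidPl.
Qed.

Lemma mc_lt_def I J : mc_lt I J = (J != I) && mc_le I J.
Proof. by []. Qed.

Lemma mc_meetC : commutative mc_meet.
Proof. by move=> I J; apply: mcP => i; rewrite !tnth_meet setIC. Qed.

Lemma mc_joinC : commutative mc_join.
Proof. by move=> I J; apply: mcP => i; rewrite !tnth_join setUC. Qed.

Lemma mc_meetA : associative mc_meet.
Proof. by move=> I J K; apply: mcP => i; rewrite !tnth_meet setIA. Qed.

Lemma mc_joinA : associative mc_join.
Proof. by move=> I J K; apply: mcP => i; rewrite !tnth_join setUA. Qed.

Lemma mc_joinKI J I : mc_meet I (mc_join I J) = I.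
Proof. by apply: mcP => i; rewrite tnth_meet tnth_join; apply/setIidPl/subsetUl. Qed.

Lemma mc_meetKU J I : mc_join I (mc_meet I J) = I.
Proof. by apply: mcP => i; rewrite tnth_join tnth_meet; apply/setUidPl/subsetIl. Qed.

Lemma mc_meetUl : left_distributive mc_meet mc_join.
Proof.
move=> I J K; apply: mcP => i.
by rewrite !(tnth_meet, tnth_join) setIUl.
Qed.

Lemma mc_meetxx : idempotent_op mc_meet.
Proof. by move=> I; apply: mcP => i; rewrite tnth_meet setIid. Qed.

End MultichainLattice.

Fact multichain_display : Order.disp_t. Proof. exact: (Order.Disp tt tt). Qed.

HB.instance Definition _ (r : nat) (d : Order.disp_t) (P : finPOrderType d) :=
  Order.isMeetJoinDistrLattice.Build multichain_display (multichain r P)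
    (@mc_le_def r d P) (@mc_lt_def r d P) (@mc_meetC r d P) (@mc_joinC r d P)
    (@mc_meetA r d P) (@mc_joinA r d P) (@mc_joinKI r d P) (@mc_meetKU r d P)
    (@mc_meetUl r d P) (@mc_meetxx r d P).

Definition strict_total_order (T : eqType) (lt : rel T) : Prop :=
  [/\ irreflexive lt, transitive lt
    & forall x y : T, x != y -> lt x y || lt y x].

(* [vlt i j] means 'X_i < 'X_j.  The last clause says that, at the smallest
   variable where a and b differ, a has the larger exponent.  The canonical
   order of mpoly.v is not this one: it fixes the order of the variables and
   breaks ties lexicographically from the largest variable. *)
Definition grevlex (m : nat) (vlt : rel 'I_m) : rel 'X_{1..m} :=
  fun a b =>
    (mdeg a < mdeg b)%N ||
    (mdeg a == mdeg b) &&
      [exists i, (b i < a i)%N && [forall j, vlt j i ==> (a j == b j)]].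

Section Groebner.

Variables (K : fieldType) (m : nat) (mlt : rel 'X_{1..m}).

Local Notation T := {mpoly K[m]}.

Definition ideal_gen (A : T -> Prop) (f : T) : Prop :=
  exists2 s : seq (T * T),
    (forall c, c \in s -> A c.2) & f = \sum_(c <- s) c.1 * c.2.

(* The mlt-largest monomial of f, for f nonzero and mlt a monomial order. *)
Definition inm (f : T) : 'X_{1..m} :=
  \big[(fun a b => if mlt a b then b else a)/0%MM]_(a <- msupp f) a.

Definition initial_ideal (L : T -> Prop) : T -> Prop :=
  ideal_gen (fun h => exists f, [/\ L f, f != 0 & h = 'X_[inm f]]).

Definition is_groebner (L : T -> Prop) (G : {fset T}) : Prop :=
  (forall g, g \in G -> L g /\ g != 0) /\
  (forall h, initial_ideal L h <->
     ideal_gen (fun h' => exists2 g, g \in G & h' = 'X_[inm g]) h).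

Definition is_reduced_groebner (L : T -> Prop) (G : {fset T}) : Prop :=
  [/\ is_groebner L G,
      forall g, g \in G -> g@_(inm g) = 1
    & forall g g', g \in G -> g' \in G -> g != g' ->
        forall a, a \in msupp g' -> ~~ (inm g <= a)%MM].

End Groebner.

Section Toric.

Variables (K : fieldType) (d : Order.disp_t) (P : finPOrderType d).
Variables (n : nat) (p : 'I_n -> P) (r : nat).

(* S has r * n variables; x_{jk} is the one of index [mxvec_index j k]. *)
Definition umon (I : multichain r P) : {mpoly K[r * n]} :=
  \prod_(j < r)
    \prod_(k < n | p k \in tnth I j :\: nth set0 (set0 :: I) j)
      'X_(mxvec_index j k).

(* T has one variable for each multichain, the one of I being that of index
   [enum_rank I]. *)
Local Notation T := {mpoly K[#|{: multichain r P}|]}.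

Definition yvar (I : multichain r P) : T := 'X_(enum_rank I).

(* The K-algebra morphism with yvar I |-> umon I, seen as taking its values in
   S; its image is the toric ring K[umon I : I]. *)
Definition phi (f : T) : {mpoly K[r * n]} :=
  mmap (@mpolyC (r * n) K) (fun i => umon (enum_val i)) f.

Definition toric_ideal (f : T) : Prop := phi f = 0.

End Toric.

Definition hibi_rels (K : fieldType) (d : Order.disp_t) (P : finPOrderType d)
    (r : nat) : {fset {mpoly K[#|{: multichain r P}|]}} :=
  [fset yvar K I * yvar K J - yvar K (I `|` J)%O * yvar K (I `&` J)%O
     | I : multichain r P, J : multichain r P & (I >< J)%O]%fset.

(* Main.v *)
Require Import Defs.
From mathcomp Require Import all_boot all_order all_algebra.
From mathcomp Require Import finmap.
From mathcomp Require Import mpoly.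

(** Each variable maps to a monomial, so [phi] is a map of monomials:
    ['X_[a]] goes to ['X_[toric_exp a]] ([phiE]), and an element of the kernel
    cannot have a monomial that is alone in its fibre of [toric_exp]
    ([toric_ideal_fibre]).

    The elements of [hibi_rels] lie in the kernel because, at each level j,
    the indicator functions of the ideals satisfy [x in A] + [x in B] =
    [x in A union B] + [x in A inter B] ([uexp_mul]).  The initial monomial of
    such a relation is y_I y_J: of the four variables involved, the
    smallest is that of the join of I and J, and it occurs only in the other
    term ([ymon_lt_incomparable]).

    By [groebnerP], it remains to see that the initial monomial a of a nonzero
    f in the kernel is divisible by some y_I y_J with I and J incomparable.
    Otherwise the support of a is a chain.  Some other monomial b of f lies in
    the fibre of a, and the heart of the proof, [standard_lt_fibre], says that
    a < b, which contradicts the maximality of a.  To see that a < b, let y_I be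
    the smallest variable with a_I <> b_I and suppose a_I < b_I.  For each j
    and x, the image of a monomial determines the number of its variables y_N
    (with multiplicity) such that x is in N_j ([toric_exp_weight]).  Comparing
    these counts for x in I_j, some y_N greater than y_I divides a and has x in
    N_j.  All these N lie in a chain; its largest element M contains I level by
    level, so that I < M and hence y_M < y_I, a contradiction.

    Reducedness holds because two distinct multichains are determined by the
    product of their variables ([ymon_dvd]), while the meet and the join of a
    pair are comparable. *)

Section ReducedGroebnerBasis.

Import Order.TTheory GRing.Theory.
Local Open Scope ring_scope.
Set Implicit Arguments.
Unset Strict Implicit.
Unset Printing Implicit Defensive.

(** * Graded reverse lexicographic order *)

Lemma exists_minimal (T : finType) (lt : rel T) (Q : pred T) :
    irreflexive lt -> transitive lt -> (exists x, Q x) ->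
  exists2 x, Q x & forall y, lt y x -> ~~ Q y.
Proof.
move=> ltxx lt_trans [x0 Qx0].
(* An element with the fewest predecessors among those satisfying Q. *)
case: (@arg_minnP T x0 Q (fun x => #|[pred y | lt y x]|) Qx0) => x Qx xmin.
exists x => // y ltyx; apply/negP => /xmin; apply/negP; rewrite -ltnNge.
apply/proper_card/properP; split; first by apply/subsetP => z /lt_trans; apply.
by exists y; rewrite !inE ?ltxx.
Qed.

Section GrevlexOrder.

Variables (m : nat) (vlt : rel 'I_m).
Hypothesis vlt_total : strict_total_order vlt.
Implicit Types a b : 'X_{1..m}.

Lemma exists_first_diff a b :
  a != b -> exists2 i, a i != b i & forall j, vlt j i -> a j = b j.
Proof.
case: vlt_total => vxx vtr _ neq_ab.
have [i ab_i i_min] : exists2 i, a i != b i &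
    forall j, vlt j i -> ~~ (a j != b j).
  apply: (@exists_minimal _ vlt (fun i => a i != b i)) => //.
  apply/existsP; apply: contraNT neq_ab => /existsPn eq_ab.
  by apply/eqP/mnmP => i; apply/eqP/negPn/eq_ab.
by exists i => // j /i_min/negPn/eqP.
Qed.

Lemma grevlexP a b :
  reflect ((mdeg a < mdeg b)%N \/ mdeg a = mdeg b /\
             exists2 i, (b i < a i)%N & forall j, vlt j i -> a j = b j)
          (grevlex vlt a b).
Proof.
apply: (iffP orP) => -[lt_ab | ]; try by left.
  case/andP=> /eqP dab /existsP[i /andP[ba /forallP eq_ab]].
  right; split=> //; exists i => // j ji.
  by apply/eqP; move: (eq_ab j); rewrite ji.
case=> dab [i ba eq_ab]; right; rewrite dab eqxx /=.
apply/existsP; exists i; rewrite ba /=; apply/forallP => j.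
by apply/implyP => /eq_ab->.
Qed.

Lemma grevlex_total : strict_total_order (grevlex vlt).
Proof.
have [vxx vtr vtot] := vlt_total; split.
- move=> a; apply/negP => /grevlexP[|[_ [i]]]; by rewrite ltnn.
- move=> b a c /grevlexP[dab|[dab [i bai eab]]]
    /grevlexP[dbc|[dbc [k cbk ebc]]]; apply/grevlexP.
  + by left; apply: ltn_trans dbc.
  + by left; rewrite -dbc.
  + by left; rewrite dab.
  right; rewrite dab; split=> //.
  have [eik | /vtot/orP[ik | ki]] := eqVneq i k.
  + subst k; exists i; first exact: ltn_trans bai.
    by move=> j ji; rewrite eab ?ebc.
  + exists i; first by rewrite -ebc.
    by move=> j ji; rewrite eab // ebc //; apply: vtr ik.
  + exists k; first by rewrite eab.
    by move=> j jk; rewrite eab ?ebc //; apply: vtr ki.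
- move=> a b neq_ab; have [i] := exists_first_diff neq_ab.
  case: (ltngtP (mdeg a) (mdeg b)) => dab.
  + by move=> _ _; apply/orP; left; apply/grevlexP; left.
  + by move=> _ _; apply/orP; right; apply/grevlexP; left.
  rewrite neq_ltn => /orP[lt_i | lt_i] eq_ab; apply/orP; [right | left];
    by apply/grevlexP; right; split=> //; exists i => // j /eq_ab.
Qed.

Lemma grevlex_ge0 a : ~~ grevlex vlt a 0%MM.
Proof.
apply/negP => /grevlexP[|[d0 [i]]]; first by rewrite mdeg0.
move/eqP: d0; rewrite mdeg0 mdeg_eq0 => /eqP->; by rewrite ltnn.
Qed.

End GrevlexOrder.

(** * Initial monomials and Groebner bases *)

Section InitialIdeal.

Variables (K : fieldType) (m : nat) (mlt : rel 'X_{1..m}).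
Hypothesis mlt_total : strict_total_order mlt.
Hypothesis mlt_ge0 : forall a, ~~ mlt a 0%MM.
Local Notation T := {mpoly K[m]}.
Implicit Types f g : T.

(** The hypothesis [mlt_ge0] matters because the fold defining [inm] starts from
    the exponent 0, whether or not it belongs to the support. *)
Lemma inm_max f : f != 0 ->
  inm mlt f \in msupp f /\ forall a, a \in msupp f -> ~~ mlt (inm mlt f) a.
Proof.
have [mxx mtr mtot] := mlt_total.
rewrite -msupp_eq0 /inm; elim: (msupp f : seq _) => // x s IHs _.
rewrite big_cons; set M := (\big[_/_]_(_ <- s) _) in IHs *.
have [s0 | s_neq0] := eqVneq s [::].
  rewrite /M s0 big_nil (negbTE (mlt_ge0 x)) mem_head; split=> // a.
  by rewrite inE => /eqP->; rewrite mxx.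
have [Ms Mmax] := IHs s_neq0; case: ifPn => [ltxM | nltxM].
  rewrite inE Ms orbT; split=> // a; rewrite inE => /predU1P[-> | /Mmax //].
  by apply/negP => /mtr/(_ ltxM); rewrite mxx.
rewrite mem_head; split=> // a; rewrite inE => /predU1P[-> | /Mmax nltMa].
  by rewrite mxx.
apply/negP => ltxa; case/negP: nltxM.
have [<- // | /mtot/orP[ltaM | ltMa]] := eqVneq a M; first exact: mtr ltaM.
by case/negP: nltMa.
Qed.

Lemma ideal_gen_mono (A B : T -> Prop) :
    (forall h, A h -> exists2 q, B q & exists c, h = c * q) ->
  forall f, ideal_gen A f -> ideal_gen B f.
Proof.
move=> AB f [s sA ->]; elim: s sA => [_ | [c h] s IHs sA].
  by exists [::] => //; rewrite big_nil.
have [|s' s'B e] := IHs.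
  by move=> x xs; apply: sA; rewrite inE xs orbT.
have [q Bq [c' hE]] := AB h (sA _ (mem_head _ _)).
exists ((c * c', q) :: s').
  by move=> x; rewrite inE => /predU1P[-> // | /s'B].
by rewrite !big_cons /= hE -e mulrA.
Qed.

(** A family of elements of L is a Groebner basis as soon as the initial
    monomial of each nonzero element of L is divisible by that of a member. *)
Lemma groebnerP (L : T -> Prop) (G : {fset T}) :
    (forall g, g \in G -> L g /\ g != 0) ->
    (forall f, L f -> f != 0 ->
       exists2 g, g \in G & (inm mlt g <= inm mlt f)%MM) ->
  is_groebner mlt L G.
Proof.
move=> GL Ldiv; split=> // h; split; apply: ideal_gen_mono => {}h.
  case=> f [Lf f0 ->]; have [g Gg le_gf] := Ldiv f Lf f0.
  exists 'X_[inm mlt g]; first by exists g.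
  by exists 'X_[inm mlt f - inm mlt g]; rewrite -mpolyXD submK.
case=> g Gg ->; have [Lg g0] := GL g Gg.
exists 'X_[inm mlt g]; first by exists g.
by exists 1; rewrite mul1r.
Qed.

Lemma msupp_binomial (a b c : 'X_{1..m}) :
  c \in msupp ('X_[a] - 'X_[b] : T) -> c = a \/ c = b.
Proof.
rewrite mcoeff_msupp mcoeffB !mcoeffX.
have [-> | _] := eqVneq a c; first by left.
by have [-> | _] := eqVneq b c; [right | rewrite subrr eqxx].
Qed.

Lemma mcoeff_binomial (a b : 'X_{1..m}) :
  a != b -> ('X_[a] - 'X_[b] : T)@_a = 1.
Proof.
by move=> ab; rewrite mcoeffB !mcoeffX eqxx eq_sym (negbTE ab) subr0.
Qed.

Lemma binomial_neq0 (a b : 'X_{1..m}) : a != b -> 'X_[a] - 'X_[b] != 0 :> T.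
Proof.
move/mcoeff_binomial => ca; apply/eqP => f0.
by move/eqP: ca; rewrite f0 mcoeff0 eq_sym oner_eq0.
Qed.

Lemma inm_binomial (a b : 'X_{1..m}) :
  mlt b a -> inm mlt ('X_[a] - 'X_[b] : T) = a.
Proof.
have [mxx _ _] := mlt_total => lt_ba.
have ab : a != b by apply: contraTneq lt_ba => ->; rewrite mxx.
have [+ fmax] := inm_max (binomial_neq0 ab).
case/msupp_binomial => // inmE; suff /fmax : a \in msupp ('X_[a] - 'X_[b] : T).
  by rewrite inmE lt_ba.
by rewrite mcoeff_msupp mcoeff_binomial // oner_eq0.
Qed.

End InitialIdeal.

(** * Levels of a multichain *)

Section Multichains.

Variables (d : Order.disp_t) (P : finPOrderType d) (r : nat).
Implicit Types I J : multichain r P.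

(** The j-th ideal of a multichain for 0 <= j <= r, with the empty set for
    j = 0; the component [tnth I j], for j < r, is thus of level j + 1. *)
Definition level I (j : nat) : {set P} := nth set0 (set0 :: I) j.

Lemma level_tnth I (j : 'I_r) : level I j.+1 = tnth I j.
Proof. by rewrite (tnth_nth set0). Qed.

Lemma level_last I : level I r = [set: P].
Proof.
case: I => I Imc; rewrite /level /=; case/and3P: (Imc) => _ _ /eqP <-.
by rewrite (last_nth set0) size_tuple.
Qed.

Lemma levelS I (j : nat) : (j < r)%N -> level I j \subset level I j.+1.
Proof.
case: I => I Imc; rewrite /level /=; case/and3P: (Imc) => _ sI _ jr.
case: j jr => [|j] jr; first exact: sub0set.
by apply: (sortedP set0 sI); rewrite size_tuple.
Qed.

Lemma levelU I J (j : nat) : level (I `|` J)%O j = level I j :|: level J j.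
Proof.
case: j => [|j]; first by rewrite /level /= setU0.
case: (ltnP j r) => jr; last first.
  by rewrite /level /= !nth_default ?size_tuple ?card_ord ?setU0.
by have := Defs.tnth_join I J (Ordinal jr); rewrite -!level_tnth.
Qed.

Lemma levelI I J (j : nat) : level (I `&` J)%O j = level I j :&: level J j.
Proof.
case: j => [|j]; first by rewrite /level /= setI0.
case: (ltnP j r) => jr; last first.
  by rewrite /level /= !nth_default ?size_tuple ?card_ord ?setI0.
by have := Defs.tnth_meet I J (Ordinal jr); rewrite -!level_tnth.
Qed.

Lemma mc_leP I J :
  reflect (forall j : 'I_r, tnth I j \subset tnth J j) (I <= J)%O.
Proof. exact: forallP. Qed.

End Multichains.

(** * The toric map on monomials *)

Section ToricMonomials.

Variables (K : fieldType) (d : Order.disp_t) (P : finPOrderType d).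
Variables (n : nat) (p : 'I_n -> P) (p_bij : bijective p) (r : nat).
Implicit Types I J : multichain r P.
Local Notation N := #|{: multichain r P}|.
Implicit Types a b : 'X_{1..N}.

(** The exponent of the monomial u_I. *)
Definition uexp I : 'X_{1..r * n} :=
  (\sum_(j < r) \sum_(k < n | p k \in tnth I j :\: level I j)
     U_(mxvec_index j k))%MM.

Lemma umonE I : umon K p I = 'X_[uexp I].
Proof.
by rewrite /umon /uexp -mprodXE; apply: eq_bigr => j _; rewrite -mprodXE.
Qed.

Lemma mxvec_index_inj (j j' : 'I_r) (k k' : 'I_n) :
  (mxvec_index j k == mxvec_index j' k') = (j == j') && (k == k').
Proof.
by rewrite /mxvec_index (inj_eq (@cast_ord_inj _ _ _)) (inj_eq enum_rank_inj).
Qed.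

Lemma uexpE I (j : 'I_r) (k : 'I_n) :
  uexp I (mxvec_index j k) = (p k \in tnth I j :\: level I j) :> nat.
Proof.
rewrite mnm_sumE (bigD1 j) //= [X in (_ + X)%N]big1 ?addn0 => [|j' nj].
  rewrite mnm_sumE big_mkcond (bigD1 k) //= [X in (_ + X)%N]big1 ?addn0.
    by rewrite mnmE eqxx; case: ifP.
  by move=> k' nk; rewrite mnmE mxvec_index_inj eqxx (negbTE nk) if_same.
rewrite mnm_sumE big1 // => k' _.
by rewrite mnmE mxvec_index_inj (negbTE nj).
Qed.

(** Summing the exponents of x_{1k}, ..., x_{jk} in u_I telescopes to the
    indicator of p_k in I_j; this is one step of the sum. *)
Lemma uexpD_level I (j : 'I_r) (k : 'I_n) :
  (uexp I (mxvec_index j k) + (p k \in level I j) = (p k \in level I j.+1))%N.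
Proof.
rewrite uexpE inE -level_tnth.
have /subsetP/(_ (p k)) := levelS I (ltn_ord j).
by case: (p k \in level I j) => [-> //|_]; rewrite addn0.
Qed.

(** The exponent of the image of ['X_[a]] under [phi]. *)
Definition toric_exp a : 'X_{1..r * n} :=
  (\sum_i uexp (enum_val i) *+ a i)%MM.

Lemma phiE f :
  phi p f = \sum_(a <- msupp f) f@_a *: 'X_[toric_exp a] :> {mpoly K[r * n]}.
Proof.
rewrite /phi /mmap; apply: eq_bigr => a _; rewrite mul_mpolyC; congr (_ *: _).
rewrite /mmap1 /toric_exp -mprodXnE; apply: eq_bigr => i _.
by rewrite umonE.
Qed.

Lemma toric_ideal_fibre f a : toric_ideal (K := K) p f -> a \in msupp f ->
  exists b, [/\ b \in msupp f, b != a & toric_exp b = toric_exp a].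
Proof.
rewrite /toric_ideal phiE => f0 af.
have [/hasP[b bf /andP[nb /eqP eb]] | /hasPn noB] :=
    boolP (has (fun b => (b != a) && (toric_exp b == toric_exp a)) (msupp f)).
  by exists b.
(* Otherwise the coefficient of the image of a in phi f is that of a in f. *)
have := congr1 (mcoeff (toric_exp a)) f0; rewrite mcoeff0 raddf_sum /=.
rewrite (bigD1_seq a) //= big_seq_cond big1 ?addr0 => [|b /andP[bf nb]].
  move/eqP; rewrite mcoeffZ mcoeffX eqxx mulr1 => fa0.
  by move: af; rewrite mcoeff_msupp fa0.
have := noB b bf; rewrite nb /= => ne.
by rewrite mcoeffZ mcoeffX (negbTE ne) mulr0.
Qed.

Lemma uexp_mul I J : (uexp I + uexp J = uexp (I `|` J)%O + uexp (I `&` J)%O)%MM.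
Proof.
apply/mnmP => i; case/mxvec_indexP: i => j k; rewrite !mnmDE.
move: (uexpD_level I j k) (uexpD_level J j k) (uexpD_level (I `|` J)%O j k)
  (uexpD_level (I `&` J)%O j k).
rewrite !levelU !levelI !inE => eI eJ eU eM.
apply: (@addIn ((p k \in level I j) + (p k \in level J j))%N).
rewrite addnACA eI eJ.
have orDand (x y : bool) : (x + y = (x || y) + (x && y))%N.
  by case: x y => [] [].
by rewrite (orDand (p k \in level I j)) addnACA eU eM -orDand.
Qed.

(** The exponent of y_I y_J. *)
Definition ymon I J : 'X_{1..N} := (U_(enum_rank I) + U_(enum_rank J))%MM.

Lemma ymonE I J : yvar K I * yvar K J = 'X_[ymon I J].
Proof. by rewrite mpolyXD. Qed.

Lemma hibi_rel_toric I J : toric_ideal (K := K) p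
  (yvar K I * yvar K J - yvar K (I `|` J)%O * yvar K (I `&` J)%O).
Proof.
rewrite /toric_ideal /phi !ymonE raddfB /= !mmapX /ymon.
rewrite !commr_mmap1_M; do ?by move=> *; apply: mulrC.
by rewrite !mmap1U !enum_rankK !umonE -!mpolyXD uexp_mul subrr.
Qed.

(** The number of variables y_N of ['X_[a]], counted with multiplicity, such
    that x belongs to N_j. *)
Definition level_weight a (j : nat) (x : P) : nat :=
  (\sum_i a i * (x \in level (enum_val i) j))%N.

Lemma toric_exp_weight a b : toric_exp a = toric_exp b ->
  forall j x, (j <= r)%N -> level_weight a j x = level_weight b j x.
Proof.
have weightS c (j : 'I_r) k :
    (toric_exp c (mxvec_index j k) + level_weight c j (p k)
       = level_weight c j.+1 (p k))%N.
  rewrite mnm_sumE -big_split; apply: eq_bigr => i _ /=.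
  by rewrite mulmnE mulnC -mulnDr uexpD_level.
move=> eab j x; have [q _ pK] := p_bij; rewrite -(pK x).
elim: j => [|j IHj] jr.
  by rewrite /level_weight !big1 // => i _; rewrite inE muln0.
by rewrite -!(weightS _ (Ordinal jr)) eab /= IHj // ltnW.
Qed.

Lemma level_weight_last a x : level_weight a r x = mdeg a.
Proof.
by rewrite mdegE; apply: eq_bigr => i _; rewrite level_last inE muln1.
Qed.

(** * Standard monomials and the Hibi relations *)

Variable ylt : rel (multichain r P).
Hypothesis ylt_total : strict_total_order ylt.
Hypothesis ylt_rev : forall I J, (I < J)%O -> ylt J I.
Hypotheses (n_gt0 : (0 < n)%N) (r_gt0 : (0 < r)%N).

Local Notation vlt := (fun i j : 'I_N => ylt (enum_val i) (enum_val j)).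

Lemma vlt_total : strict_total_order vlt.
Proof.
have [yxx ytr ytot] := ylt_total; split=> [i | j i k | i j ne_ij].
- exact: yxx.
- exact: ytr.
- by apply: ytot; rewrite (inj_eq enum_val_inj).
Qed.

(** A monomial supported on a chain is the smallest of its fibre under the
    toric map. *)
Lemma standard_lt_fibre a b :
    {in [pred i | (0 < a i)%N] &, forall i j, (enum_val i >=< enum_val j)%O} ->
  toric_exp b = toric_exp a -> b != a -> grevlex vlt a b.
Proof.
move=> a_std eba neq_ba; have [vxx vtr vtot] := vlt_total.
have eW := toric_exp_weight eba.
have [i neq_i eq_lt] := exists_first_diff vlt_total neq_ba.
apply/grevlexP; right; split.
  (* The degree is a weight: every point belongs to the last ideal. *)
  by rewrite -!(level_weight_last _ (p (Ordinal n_gt0))) eW.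
exists i; last by move=> j /eq_lt.
rewrite ltnNge leq_eqVlt eq_sym (negbTE neq_i) /=; apply/negP => lt_ai.
(* C indexes the variables of a that are greater than y_i. *)
pose C := [pred j | (0 < a j)%N && vlt i j].
have above (j : 'I_r) x : x \in tnth (enum_val i) j ->
    exists2 k, k \in C & x \in tnth (enum_val k) j.
  rewrite -level_tnth => xi; apply/exists_inP.
  apply: contraT => /exists_inPn noC.
  (* If there is none, the weight of a at (j + 1, x) is at most that of b term
     by term, with strict inequality in the term of i. *)
  have := eW j.+1 x (ltn_ord j); move/eqP; rewrite gtn_eqF //.
  rewrite /level_weight (bigD1 i) // [X in (_ < X)%N](bigD1 i) //= xi !muln1.
  rewrite -addSn leq_add //; apply: leq_sum => k neq_ki.
  have [xk | ] := boolP (x \in _); last by rewrite !muln0.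
  rewrite !muln1; have /orP[ki | ik] := vtot _ _ neq_ki; first by rewrite eq_lt.
  have [-> // | ak] := posnP (a k).
  by have := noC k; rewrite -level_tnth xk inE ak ik => /(_ isT).
have comparableC : {in C &, forall j k, (enum_val j >=< enum_val k)%O}.
  by move=> j k /andP[aj _] /andP[ak _]; apply: a_std.
have [M CM Mmax] : exists2 M, C M &
    forall k, (enum_val M < enum_val k :> multichain r P)%O -> ~~ C k.
  apply: (@exists_minimal _ (fun k l => (enum_val l < enum_val k)%O)).
  - by move=> k; apply: ltxx.
  - by move=> l k m kl lm; apply: lt_trans lm kl.
  (* C is not empty: the last ideal of the multichain of i is all of P. *)
  have r1 : (r.-1 < r)%N by rewrite prednK.
  have [|k Ck _] := above (Ordinal r1) (p (Ordinal n_gt0)); last by exists k.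
  by rewrite -level_tnth /= prednK // level_last inE.
have le_iM : (enum_val i <= enum_val M)%O.
  apply/mc_leP => j; apply/subsetP => x /above[k Ck].
  suff /mc_leP/(_ j)/subsetP : (enum_val k <= enum_val M)%O by apply.
  have /orP[// | ] := comparableC k M Ck CM.
  by rewrite le_eqVlt => /predU1P[-> // | /Mmax/negP[]].
have /andP[_ lt_iM] := CM.
move: le_iM; rewrite le_eqVlt => /predU1P[/enum_val_inj eiM | /ylt_rev ltMi].
  by rewrite eiM vxx in lt_iM.
by have := vtr _ _ _ lt_iM ltMi; rewrite vxx.
Qed.

(** The variable of the join is smaller than those of I, J and their meet, and
    it divides only the left-hand monomial. *)
Lemma ymon_lt_incomparable I J : (I >< J)%O ->
  grevlex vlt (ymon (I `|` J)%O (I `&` J)%O) (ymon I J).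
Proof.
move=> nIJ; have [yxx ytr ytot] := ylt_total.
have lt_IU : (I < I `|` J)%O.
  rewrite lt_neqAle leUl andbT; apply: contraNneq nIJ => IU.
  by rewrite /Order.comparable IU leUr orbT.
have lt_JU : (J < I `|` J)%O.
  rewrite lt_neqAle leUr andbT; apply: contraNneq nIJ => JU.
  by rewrite /Order.comparable JU leUl.
have lt_MU : (I `&` J < I `|` J)%O by apply: le_lt_trans lt_IU; apply: leIl.
apply/grevlexP; right; split; first by rewrite !mdegD !mdeg1.
exists (enum_rank (I `|` J)%O).
  by rewrite !mnmE eqxx !(inj_eq enum_rank_inj) !lt_eqF.
move=> j; rewrite enum_rankK => ltjU.
have neqj A : (A <= I `|` J)%O -> (enum_rank A == j) = false.
  move=> leAU; apply/eqP => eAj; move: ltjU; rewrite -eAj enum_rankK.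
  move: leAU; rewrite le_eqVlt => /predU1P[-> | /ylt_rev ltUA ltAU].
    by rewrite yxx.
  by have := ytr _ _ _ ltUA ltAU; rewrite yxx.
by rewrite !mnmE !neqj // ltW.
Qed.

Lemma ymon_dvd I J A B : I != J -> (ymon I J <= ymon A B)%MM ->
  I = A /\ J = B \/ I = B /\ J = A.
Proof.
move=> nIJ /mnm_lepP le_y.
move: (le_y (enum_rank I)) (le_y (enum_rank J)).
rewrite !mnmE !eqxx !(inj_eq enum_rank_inj) (negbTE nIJ) eq_sym (negbTE nIJ).
have [eAI | nAI] := eqVneq A I; have [eBI | nBI] := eqVneq B I;
  have [eAJ | nAJ] := eqVneq A J; have [eBJ | nBJ] := eqVneq B J => //= _ _;
  subst; by [left | right | rewrite eqxx in nIJ].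
Qed.

Lemma hibi_relsP (g : {mpoly K[N]}) : reflect
  (exists2 IJ, (IJ.1 >< IJ.2)%O &
     g = 'X_[ymon IJ.1 IJ.2]
         - 'X_[ymon (IJ.1 `|` IJ.2)%O (IJ.1 `&` IJ.2)%O])
  (g \in hibi_rels K P r).
Proof.
apply: (iffP (imfset2P _ _ _ _ _)).
- case=> I _ [J /andP[_ nIJ] ->].
  by exists (I, J); rewrite -?ymonE.
- case=> -[I J] /= nIJ ->.
  by exists I => //; exists J; rewrite -?ymonE.
Qed.

Lemma inm_hibi_rel I J : (I >< J)%O ->
  inm (grevlex vlt) ('X_[ymon I J]
    - 'X_[ymon (I `|` J)%O (I `&` J)%O] : {mpoly K[N]}) = ymon I J.
Proof.
move=> nIJ; apply: inm_binomial (ymon_lt_incomparable nIJ).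
  exact/grevlex_total/vlt_total.
exact/grevlex_ge0.
Qed.

Lemma hibi_monomials_neq I J : (I >< J)%O ->
  ymon I J != ymon (I `|` J)%O (I `&` J)%O.
Proof.
move/ymon_lt_incomparable; apply: contraTneq => ->.
by have [/(_ (ymon _ _))->] := grevlex_total vlt_total.
Qed.

Lemma hibi_rels_groebner :
  is_groebner (grevlex vlt) (toric_ideal (K := K) p (r := r)) (hibi_rels K P r).
Proof.
have gtot := grevlex_total vlt_total.
apply: groebnerP => [g /hibi_relsP[[I J] /= nIJ ->] | f Lf f0].
  split; last exact/binomial_neq0/hibi_monomials_neq.
  by rewrite -!ymonE; apply: hibi_rel_toric.
have [fin fmax] := inm_max gtot (@grevlex_ge0 _ vlt) f0.
set m := inm _ f in fin fmax *.
have [| no_pair] := boolP [exists i, exists j,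
  [&& (0 < m i)%N, (0 < m j)%N & (enum_val i >< enum_val j)%O]].
  case/existsP=> i /existsP[j /and3P[mi mj nij]].
  exists ('X_[ymon (enum_val i) (enum_val j)]
   - 'X_[ymon (enum_val i `|` enum_val j)%O (enum_val i `&` enum_val j)%O]).
    by apply/hibi_relsP; exists (enum_val i, enum_val j).
  rewrite inm_hibi_rel //; apply/mnm_lepP => k; rewrite !mnmE !enum_valK.
  have [eik | nik] := eqVneq i k; last by case: eqVneq => // <-.
  have [ejk | njk] := eqVneq j k; last by rewrite -eik.
  by move: nij; rewrite eik ejk comparablexx.
have [b [bf neq_bm eb]] := toric_ideal_fibre Lf fin.
case/negP: (fmax b bf); apply: standard_lt_fibre => // i j mi mj.
apply: contraNT no_pair => nij.
by apply/existsP; exists i; apply/existsP; exists j; apply/and3P.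
Qed.

Lemma hibi_rels_reduced (g g' : {mpoly K[N]}) :
    g \in hibi_rels K P r -> g' \in hibi_rels K P r -> g != g' ->
  forall a, a \in msupp g' -> ~~ (inm (grevlex vlt) g <= a)%MM.
Proof.
move=> /hibi_relsP[[I J] /= nIJ ->] /hibi_relsP[[I' J'] /= nIJ' ->].
have neqIJ : I != J by apply: contraNneq nIJ => ->; rewrite comparablexx.
move=> neq_g a; rewrite inm_hibi_rel // => /msupp_binomial aE.
apply/negP => le_a.
case: aE le_a => -> /(ymon_dvd neqIJ)[[eI eJ] | [eI eJ]]; subst.
- by rewrite eqxx in neq_g.
- by rewrite joinC meetC /ymon [(U_(enum_rank J') + _)%MM]addmC eqxx in neq_g.
- by rewrite /Order.comparable lexU2 ?orbT // ?leIl in nIJ.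
- by rewrite /Order.comparable lexU2 ?leIl in nIJ.
Qed.

End ToricMonomials.

End ReducedGroebnerBasis.

(* [ylt I J] means y_I < y_J *)
Theorem theorem4p1 (K : fieldType) (d : Order.disp_t) (P : finPOrderType d)
    (n : nat) (n_gt0 : (0 < n)%N) (p : 'I_n -> P) (p_bij : bijective p)
    (r : nat) (r_gt0 : (0 < r)%N)
    (ylt : rel (multichain r P)) (ylt_total : strict_total_order ylt)
    (ylt_rev : forall I J : multichain r P, (I < J)%O -> ylt J I) :
  is_reduced_groebner
    (grevlex (fun i j => ylt (enum_val i) (enum_val j)))
    (toric_ideal (K := K) p (r := r))
    (hibi_rels K P r).
Proof.
split; first exact: hibi_rels_groebner.
  move=> g /hibi_relsP[[I J] /= nIJ ->].
  by rewrite inm_hibi_rel // mcoeff_binomial // (hibi_monomials_neq ylt_total).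
exact: hibi_rels_reduced.
Qed.
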